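(* Let $d\geq 2$. Then there exists a monotone increasing function $\beta_{d}\colon [1,\infty)\to [1,\infty)$ such that $2\lfloor t\rfloor-1\leq\beta_{d}(t)\leq 2^{8dt}$ for all $t\in [1,\infty)$ and the following holds: Let $T,N\in \mathbb{N}$, $m\in\mathbb{R}$ and let $\sigma\colon \frac{1}{N}\mathbb{Z}^{d-1}\to \frac{1}{N}\mathbb{Z}^{d-1}$ be a permutation with $\|\sigma(x)-x\|\leq T$ for all $x\in \frac{1}{N}\mathbb{Z}^{d-1}$. Then there exists an $N\beta_{d}(6NT)^{3^{d-1}}$-bilipschitz mapping \[\Upsilon\colon\mathbb{R}^{d-1}\times[m-\tfrac{1}{2},m+\tfrac{1}{2}]\to \mathbb{R}^{d-1}\times [m-\tfrac{1}{2},m+\tfrac{1}{2}]\] such that (i) $\Upsilon(x)=x$ for all $x\in\mathbb{R}^{d-1}\times \{m-\frac{1}{2},m+\frac{1}{2}\}$, and (ii) $\Upsilon(x,m)=(\sigma(x),m)$ for all $x\in \frac{1}{N}\mathbb{Z}^{d-1}$. Moreover, $\beta_d$ may be taken to be the function $\beta_d$ defined in the context below.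
   Context: $\|\cdot\|$ is the Euclidean norm. A mapping is $L$-bilipschitz if it is injective and both it and its inverse are $L$-Lipschitz. Definition of $\beta_d$: let $\mathcal{F}_d$ be the collection of all monotone increasing functions $\psi\colon[1,\infty)\to[1,\infty)$ such that the following holds: for every $S\in\mathbb{N}$, with $Q:=(-\frac12,\dots,-\frac12)+[0,S]^{d-1}\subseteq\mathbb{R}^{d-1}$, and every permutation $\sigma\colon\mathbb{Z}^{d-1}\to\mathbb{Z}^{d-1}$ such that for each $z\in\mathbb{Z}^{d-1}$ the restriction of $\sigma$ to $\mathbb{Z}^{d-1}\cap(Q+Sz)$ is a permutation of $\mathbb{Z}^{d-1}\cap(Q+Sz)$, there is a $\psi(S)$-bilipschitz mapping $\Upsilon\colon\mathbb{R}^d\to\mathbb{R}^d$ with $\Upsilon(x)=x$ for all $x\in\mathbb{R}^{d-1}\times(\mathbb{R}\setminus(-\frac12,\frac12))$ and $\Upsilon(x,0)=(\sigma(x),0)$ for all $x\in\mathbb{Z}^{d-1}$. Then $\beta_d$ is the pointwise infimum of $\mathcal{F}_d$. *)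

(* Defs.v *)
From mathcomp Require Import all_boot all_order all_algebra.
From mathcomp Require Import all_classical all_reals exp.
Set Implicit Arguments. Unset Strict Implicit. Unset Printing Implicit Defensive.
Import Order.TTheory GRing.Theory Num.Theory.
Local Open Scope ring_scope.
Local Open Scope classical_set_scope.

Section Defs.
Variable R : realType.

(* Points of R^k are functions 'I_k -> R; points of R^(k+1) = R^k x R are pairs. *)

Definition enorm (k : nat) (x : 'I_k -> R) : R :=
  Num.sqrt (\sum_(i < k) (x i) ^+ 2).

Definition edist (k : nat) (p q : ('I_k -> R) * R) : R :=
  Num.sqrt (\sum_(i < k) (p.1 i - q.1 i) ^+ 2 + (p.2 - q.2) ^+ 2).

Definition bilipschitz_on (k : nat) (L : R) (A : set (('I_k -> R) * R))
    (f : ('I_k -> R) * R -> ('I_k -> R) * R) : Prop :=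
  [/\ (forall p q, A p -> A q -> f p = f q -> p = q),
      (forall p q, A p -> A q -> edist (f p) (f q) <= L * edist p q) &
      (forall p q, A p -> A q -> edist p q <= L * edist (f p) (f q))].

Definition intvec (k : nat) (z : 'I_k -> int) : 'I_k -> R := fun i => (z i)%:~R.

(* the point z lies in Q + S w, with Q = (-1/2,...,-1/2) + [0,S]^k *)
Definition in_block (k S : nat) (w z : 'I_k -> int) : Prop :=
  forall i, - 2^-1 + S%:R * (w i)%:~R <= (z i)%:~R :> R /\
            (z i)%:~R <= - 2^-1 + S%:R + S%:R * (w i)%:~R :> R.

Definition block_perm (k S : nat) (sigma : ('I_k -> int) -> ('I_k -> int)) : Prop :=
  bijective sigma /\
  forall w : 'I_k -> int,
    (forall z, in_block S w z -> in_block S w (sigma z)) /\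
    (forall z, in_block S w z -> exists2 y, in_block S w y & sigma y = z).

(* monotone increasing function [1,oo) -> [1,oo) (values off [1,oo) irrelevant) *)
Definition monotone_ge1 (psi : R -> R) : Prop :=
  (forall t, 1 <= t -> 1 <= psi t) /\
  (forall s t, 1 <= s -> s <= t -> psi s <= psi t).

Definition F_fam (d : nat) : set (R -> R) :=
  [set psi | monotone_ge1 psi /\
    forall (S : nat) (sigma : ('I_d.-1 -> int) -> ('I_d.-1 -> int)),
      (0 < S)%N -> block_perm S sigma ->
      exists Ups : ('I_d.-1 -> R) * R -> ('I_d.-1 -> R) * R,
        [/\ bilipschitz_on (psi S%:R) setT Ups,
            (forall p, ~ (- 2^-1 < p.2 < 2^-1) -> Ups p = p) &
            (forall z, Ups (intvec z, 0) = (intvec (sigma z), 0))]].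

Definition beta (d : nat) (t : R) : R := inf [set psi t | psi in F_fam d].

Definition grid (k N : nat) (x : 'I_k -> R) : Prop :=
  forall i, exists z : int, x i = z%:~R / N%:R.

End Defs.

(* Main.v *)
Require Import Defs.
From mathcomp Require Import all_boot all_order all_algebra.
From mathcomp Require Import all_classical all_reals exp.
From mathcomp Require Import ring lra zify.
Import Order.TTheory GRing.Theory Num.Theory.
Local Open Scope ring_scope.
Local Open Scope classical_set_scope.

(** Let [k = d - 1] and let [D] bound the displacement of a permutation of [Z^k].
    Colour [Z^k] by residues modulo [4 D] and give the [n = (4 D)^k] colours
    heights in [[-1/6, 1/6]] at mutual distance [1 / (3 n)].  Lift every lattice
    point to the height of its colour, shift it horizontally to its target, and
    lower it again.  Each of the three maps has the form [id + v], where [v]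
    is prescribed at the lattice points, vanishes outside the strip, and is
    extended by McShane's lemma for the weighted metric [a |dx| + b |dy|].
    Since points of one colour are [4 D] apart, [a = 1/2] always suffices, so
    the maps have Lipschitz inverses on their images, and only the shift needs a large [b], namely
    [6 D n].  The resulting constant of order [D^(k+1)] lies below [2^(8 (k+1) S)]
    for block permutations ([D = S]), and below [beta(6NT)^(3^k)] for [D = N T],
    thanks to [beta(t) >= 2 floor(t) - 1]. *)

(** * The sup norm and near-identity maps in the sum metric *)

Lemma neq_coord (k : nat) (z w : 'I_k -> int) : z <> w -> exists i, z i != w i.
Proof.
move=> zw; apply/existsP; apply: contra_notT zw => /existsPn zw.
by apply/funext => i; apply/eqP/negPn/zw.
Qed.

Section SupNorm.
Context {R : realType} {k : nat}.
Implicit Types x y : 'I_k -> R.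

Definition supn x : R := \big[Num.max/0]_(i < k) `|x i|.

Lemma supn_ge0 x : 0 <= supn x.
Proof. by rewrite /supn; elim/big_rec: _ => // i y _; rewrite le_max => ->; rewrite orbT. Qed.

Lemma le_supn x i : `|x i| <= supn x.
Proof. exact: (le_bigmax _ (fun i => `|x i|)). Qed.

Lemma supn_le x r : 0 <= r -> (forall i, `|x i| <= r) -> supn x <= r.
Proof. by move=> r0 xr; apply: bigmax_le. Qed.

Lemma supn_enorm x : supn x <= enorm x.
Proof.
apply: supn_le; first exact: sqrtr_ge0.
move=> i; rewrite -sqrtr_sqr ler_sqrt; last by apply: sumr_ge0 => j _; apply: sqr_ge0.
by rewrite (bigD1 i) //= lerDl; apply: sumr_ge0 => j _; apply: sqr_ge0.
Qed.

End SupNorm.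

Section Metric.
Context {R : realType} {k : nat}.
Local Notation P := (('I_k -> R) * R)%type.
Implicit Types (p q : P) (f g : P -> P).

Definition hdist p q : R := supn (fun i => p.1 i - q.1 i).

Lemma hdist_ge0 p q : 0 <= hdist p q.
Proof. exact: supn_ge0. Qed.

Lemma hdistC p q : hdist p q = hdist q p.
Proof. by apply: eq_bigr => i _; rewrite distrC. Qed.

Lemma hdistxx p : hdist p p = 0.
Proof.
by apply/eqP; rewrite eq_le hdist_ge0 andbT; apply: supn_le => // i; rewrite subrr normr0.
Qed.

Lemma hdist_triangle p q r : hdist p r <= hdist p q + hdist q r.
Proof.
apply: supn_le => [|i]; first by rewrite addr_ge0 ?hdist_ge0.
have -> : p.1 i - r.1 i = (p.1 i - q.1 i) + (q.1 i - r.1 i) by ring.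
by rewrite (le_trans (ler_normD _ _)) // lerD // (le_supn (fun i => _ i - _ i)).
Qed.

Lemma hdist_intvec_ge (z w : 'I_k -> int) (m : nat) i y y' :
  (m%:Z <= `|z i - w i|) -> m%:R <= hdist (intvec R z, y) (intvec R w, y').
Proof.
move=> mi; apply: le_trans (le_supn _ i); rewrite /= /intvec -intrB -intr_norm.
by rewrite -[m%:R]/(m%:Z%:~R) ler_int.
Qed.

Lemma hdist_intvec_ge1 (z w : 'I_k -> int) y y' :
  z <> w -> 1 <= hdist (intvec R z, y) (intvec R w, y').
Proof.
move=> /neq_coord[i zwi].
by apply: (@hdist_intvec_ge _ _ 1 i); lia.
Qed.

(** Stated for the sum of the horizontal sup distance and the height difference instead of the
    Euclidean distance: the estimates below become linear, and only a factor [2 * k.+1] is lost on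
    returning to [edist]. *)
Definition bilip (K : R) f : Prop :=
  forall p q,
    hdist (f p) (f q) + `|(f p).2 - (f q).2| <= K * (hdist p q + `|p.2 - q.2|) /\
    hdist p q + `|p.2 - q.2| <= K * (hdist (f p) (f q) + `|(f p).2 - (f q).2|).

Lemma bilip_comp K K' f g : 0 <= K -> 0 <= K' ->
  bilip K f -> bilip K' g -> bilip (K * K') (f \o g).
Proof.
move=> K0 K'0 fK gK p q; have [f1 f2] := fK (g p) (g q); have [g1 g2] := gK p q.
split=> /=.
  by rewrite (le_trans f1) // -mulrA ler_wpM2l.
by rewrite (le_trans g2) // [K * K']mulrC -mulrA ler_wpM2l.
Qed.

(** The perturbation changes the sum distance by at most half of it, so distances stay between 1/2
    and 3/2 of their old values. *)
Lemma vertical_bilip (g : P -> R) :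
  (forall p q, `|g p - g q| <= 2^-1 * hdist p q + 2^-1 * `|p.2 - q.2|) ->
  bilip 2 (fun p => (p.1, p.2 + g p)).
Proof.
move=> gL p q /=; have -> y y' : hdist (p.1, y) (q.1, y') = hdist p q by [].
have -> : p.2 + g p - (q.2 + g q) = (p.2 - q.2) + (g p - g q) by ring.
have := gL p q; have := hdist_ge0 p q.
have := ler_normD (p.2 - q.2) (g p - g q); have := lerB_normD (p.2 - q.2) (g p - g q).
by split; lra.
Qed.

(** A steep dependence on the height is harmless, because the height difference [y] survives the
    map. With [h] and [d'] the old and new horizontal distances, [h <= d' + h / 2 + M y] gives
    [h <= 2 d' + 2 M y]; adding [y] yields the factor [2 M + 1]. *)
Lemma horizontal_bilip (u : 'I_k -> P -> R) (M : R) : 1 <= M ->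
  (forall i p q, `|u i p - u i q| <= 2^-1 * hdist p q + M * `|p.2 - q.2|) ->
  bilip (2 * M + 1) (fun p => (fun i => p.1 i + u i p, p.2)).
Proof.
move=> M1 uL p q /=; set d' := hdist _ _.
have h0 := hdist_ge0 p q; have y0 := normr_ge0 (p.2 - q.2).
have My : 0 <= M * `|p.2 - q.2| by rewrite mulr_ge0 //; lra.
have Mh : hdist p q <= M * hdist p q by rewrite ler_peMl.
have uD i : p.1 i + u i p - (q.1 i + u i q) = (p.1 i - q.1 i) + (u i p - u i q) by ring.
have le1 : d' <= hdist p q + (2^-1 * hdist p q + M * `|p.2 - q.2|).
  apply: supn_le => [|i /=]; first by lra.
  have := uL i p q; have := le_supn (fun i => p.1 i - q.1 i) i.
  have := ler_normD (p.1 i - q.1 i) (u i p - u i q); rewrite uD.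
  by rewrite -/(hdist p q) => /=; lra.
have d0 : 0 <= d' by exact: hdist_ge0.
have le2 : hdist p q <= d' + (2^-1 * hdist p q + M * `|p.2 - q.2|).
  apply: supn_le => [|i /=]; first by lra.
  have : `|p.1 i + u i p - (q.1 i + u i q)| <= d'.
    exact: (le_supn (fun i => p.1 i + u i p - (q.1 i + u i q))).
  have := uL i p q.
  have := lerB_normD (p.1 i - q.1 i) (u i p - u i q); rewrite -uD.
  by lra.
have Md : d' <= M * d' by rewrite ler_peMl.
split; lra.
Qed.

End Metric.

(** * Lipschitz extension of data prescribed in a strip *)

Section Extension.
Context {R : realType}.

(** The extension is the infimum of [v + rho p q] over all data [(q, v)]. Data form a relation, so
    that lattice values and boundary values can be joined without a case split; the last hypothesis
    with [p = q] makes it single-valued. *)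
Lemma mcshane {T : Type} (rho : T -> T -> R) (E : T -> R -> Prop) :
  (forall p, rho p p = 0) -> (forall p q, rho p q = rho q p) ->
  (forall p q r, rho p r <= rho p q + rho q r) ->
  (forall p v q w, E p v -> E q w -> v - w <= rho p q) ->
  exists g : T -> R, (forall p v, E p v -> g p = v) /\
                     (forall p q, `|g p - g q| <= rho p q).
Proof.
move=> rho0 rhoC rho_tri EL.
have rho_ge0 p q : 0 <= rho p q.
  by have := rho_tri p q p; rewrite rho0 (rhoC q); lra.
(* One datum supplies the lower bound that makes the infima meaningful; without data the zero
   function is chosen. *)
have [[p0 [v0 E0]]|noE] := pselect (exists p v, E p v); last first.
  exists (fun=> 0); split=> [p v Epv|p q]; last by rewrite subrr normr0.
  by exfalso; apply: noE; exists p, v.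
pose A p : set R := [set t | exists q v, E q v /\ t = v + rho p q].
have A_lb p : has_lbound (A p).
  exists (v0 - rho p p0) => _ [q [v [Eqv ->]]].
  by have := EL _ _ _ _ E0 Eqv; have := rho_tri p0 p q; rewrite (rhoC p0 p); lra.
have A_n0 p : A p !=set0 by exists (v0 + rho p p0), p0, v0.
have le_inf_A p q : inf (A p) <= inf (A q) + rho p q.
  rewrite -lerBlDr; apply: lb_le_inf => // _ [r [v [Erv ->]]].
  have : inf (A p) <= v + rho p r by apply: ge_inf => //; exists r, v.
  by have := rho_tri p q r; lra.
exists (fun p => inf (A p)); split.
  move=> p v Epv; apply/eqP; rewrite eq_le; apply/andP; split.
    by apply: ge_inf => //; exists p, v; rewrite rho0 addr0.
  apply: lb_le_inf => // _ [q [w [Eqw ->]]].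
  by have := EL _ _ _ _ Epv Eqw; lra.
move=> p q; rewrite ler_norml; have := le_inf_A p q; have := le_inf_A q p.
by rewrite (rhoC q); lra.
Qed.

Context {k : nat}.
Local Notation P := (('I_k -> R) * R)%type.

(** The data are [val] at the points [pt i] and 0 outside the open strip. The second bound on [val]
    is the compatibility between the two kinds: [2^-1 - |y|] is the vertical distance from a point
    of height [y] in the strip to its boundary. *)
Lemma strip_extension {I : Type} (pt : I -> P) (val : I -> R) (b : R) : 0 <= b ->
  (forall i j, val i - val j <=
     2^-1 * hdist (pt i) (pt j) + b * `|(pt i).2 - (pt j).2|) ->
  (forall i, `|val i| <= b * (2^-1 - `|(pt i).2|)) ->
  exists g : P -> R, [/\ forall i, g (pt i) = val i,
    forall p, 2^-1 <= `|p.2| -> g p = 0 &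
    forall p q, `|g p - g q| <= 2^-1 * hdist p q + b * `|p.2 - q.2|].
Proof.
move=> b0 valL val_bd.
pose rho (p q : P) : R := 2^-1 * hdist p q + b * `|p.2 - q.2|.
pose E (p : P) (v : R) := (exists2 i, pt i = p & val i = v) \/ (2^-1 <= `|p.2| /\ v = 0).
have rho_bd i (q : P) : 2^-1 <= `|q.2| -> `|val i| <= rho (pt i) q.
  move=> q2; rewrite (le_trans (val_bd i)) // /rho.
  have bq : b * (2^-1 - `|(pt i).2|) <= b * `|(pt i).2 - q.2|.
    apply: ler_wpM2l => //; have := lerB_dist q.2 (pt i).2; rewrite distrC; lra.
  by have := hdist_ge0 (pt i) q; lra.
have rhoC p q : rho p q = rho q p by rewrite /rho hdistC distrC.
have [||||g [gE gL]] := @mcshane P rho E.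
- by move=> p; rewrite /rho hdistxx subrr normr0 !mulr0 addr0.
- exact: rhoC.
- move=> p q r; rewrite /rho.
  have bpqr : b * `|p.2 - r.2| <= b * `|p.2 - q.2| + b * `|q.2 - r.2|.
    by rewrite -mulrDr ler_wpM2l // ler_distD.
  by have := hdist_triangle p q r; lra.
- move=> p v q w [[i <- <-]|[p2 ->]] [[j <- <-]|[q2 ->]].
  + exact: valL.
  + by rewrite subr0 (le_trans (ler_norm _)) // rho_bd.
  + by rewrite sub0r (le_trans (ler_norm _)) // normrN rhoC rho_bd.
  + by rewrite subrr addr_ge0 // mulr_ge0 ?hdist_ge0 // invr_ge0.
exists g; split => // [i|p p2]; apply: gE; first by left; exists i.
by right.
Qed.

End Extension.

(** * Residue colouring of the lattice and heights of the colours *)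

Lemma eqz_mod_dist (q : nat) (a b : int) :
  `|(a %% q)%Z|%N = `|(b %% q)%Z|%N -> a != b -> (q%:Z <= `|a - b|).
Proof.
move=> ab neq; have [->|q0] := posnP q; first by lia.
have q0' : q%:Z != 0 by lia.
have : (a %% q)%Z = (b %% q)%Z.
  by have := modz_ge0 a q0'; have := modz_ge0 b q0'; lia.
move/eqP; rewrite eqz_mod_dvd => /dvdzP[c cE].
by have : c != 0; [apply: contraNneq neq => c0; lia | rewrite cE normrM; nia].
Qed.

(* The height encodes the residue class modulo [q]. *)
Lemma separating_heights (R : realType) (k q : nat) : (0 < q)%N ->
  exists h : ('I_k -> int) -> R, (forall z, `|h z| <= 6^-1) /\
    (forall z w, z <> w ->
       q%:R <= hdist (intvec R z, h z) (intvec R w, h w) \/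
       (3 * (q ^ k)%:R)^-1 <= `|h z - h w|).
Proof.
move=> q0.
pose c (z : 'I_k -> int) : {ffun 'I_k -> 'I_q.-1.+1} := [ffun i => inord `|(z i %% q)%Z|%N].
pose n : nat := #|{ffun 'I_k -> 'I_q.-1.+1}|.
have nE : n = (q ^ k)%N by rewrite /n card_ffun !card_ord prednK.
have n0 : 0 < n%:R :> R by rewrite ltr0n nE expn_gt0 q0.
(* Ranks of colours divided by [3 n] fill at most [0, 1/3], with gaps at least [1 / (3 n)];
   subtracting 1/6 centres them at height 0. *)
pose h z : R := (enum_rank (c z))%:R / (3 * n%:R) - 6^-1.
have cB z : 0 <= (enum_rank (c z))%:R / (3 * n%:R : R) <= 3^-1.
  rewrite divr_ge0 //=; last by lra.
  rewrite ler_pdivrMr; last by lra.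
  by rewrite mulKf ?pnatr_eq0 // ler_nat ltnW.
exists h; split=> [z|z w zw].
  by rewrite ler_norml /h; have := cB z; lra.
have [cE|cN] := eqVneq (c z) (c w).
  left; have [i zwi] := neq_coord _ z w zw.
  apply: (@hdist_intvec_ge _ _ _ _ _ i); apply: eqz_mod_dist zwi.
  have lt_q (a : int) : (`|(a %% q)%Z| < q.-1.+1)%N.
    have q0' : q%:Z != 0 by lia.
    rewrite prednK //; have := modz_ge0 a q0'; have := ltz_pmod a (_ : 0 < q%:Z); lia.
  by move/ffunP/(_ i): cE; rewrite !ffunE => /(congr1 (@nat_of_ord _)); rewrite !inordK.
right; rewrite -nE /h.
set a := enum_rank (c z); set b := enum_rank (c w).
have -> : a%:R / (3 * n%:R) - 6^-1 - (b%:R / (3 * n%:R) - 6^-1) =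
   (a%:R - b%:R) / (3 * n%:R) :> R by ring.
rewrite normrM [`|_^-1|]ger0_norm ?invr_ge0; last by lra.
rewrite ler_peMl ?invr_ge0 //; first by lra.
have : (a : nat) != b by apply: contraNneq cN => /val_inj/enum_rank_inj ->.
rewrite -[a%:R]/((a%:Z)%:~R) -[b%:R]/((b%:Z)%:~R) -intrB -intr_norm ler1z.
by lia.
Qed.

(** * Realizing a bounded displacement by lift, shift and lowering *)

Section Realization.
Context {R : realType} {k : nat}.
Local Notation P := (('I_k -> R) * R)%type.

Lemma displacement_realization (D : nat) (s : ('I_k -> int) -> ('I_k -> int)) :
  (0 < D)%N -> injective s -> (forall z i, `|s z i - z i| <= D%:Z) ->
  exists f : P -> P,
    [/\ bilip (4 * (2 * (6 * D%:R * ((4 * D) ^ k)%:R) + 1)) f,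
        forall p, 2^-1 <= `|p.2| -> f p = p,
        forall p, `|p.2| <= 2^-1 -> `|(f p).2| <= 2^-1 &
        forall z, f (intvec R z, 0) = (intvec R (s z), 0)].
Proof.
move=> D0 s_inj sD; set n := ((4 * D) ^ k)%N.
have [|h [h_bd h_sep]] := separating_heights R k (4 * D); first by rewrite muln_gt0.
have D1 : 1 <= D%:R :> R by rewrite ler1n.
have n1 : 1 <= n%:R :> R by rewrite ler1n /n expn_gt0 muln_gt0 D0.
have h_bd2 z : - 6^-1 <= h z <= 6^-1 by rewrite -ler_norml.
have half0 : 0 <= 2^-1 :> R by rewrite invr_ge0.
have [z w|z|l [lE l0 lL]] :=
    @strip_extension R k ('I_k -> int) (fun z => (intvec R z, 0)) h 2^-1 half0.
- rewrite /= subrr normr0 mulr0 addr0.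
  have [->|/hdist_intvec_ge1] := pselect (z = w).
    by rewrite subrr mulr_ge0 // hdist_ge0.
  (* Heights differ by at most 1/3, and distinct lattice points are at least 1 apart, so slope 1/2
     suffices. *)
  by move=> /(_ R 0 0) hd; have := h_bd2 z; have := h_bd2 w; lra.
- by rewrite /= normr0; have := h_bd z; lra.
have [z w|z|g [gE g0 gL]] :=
    @strip_extension R k ('I_k -> int) (fun z => (intvec R (s z), h z)) (fun z => - h z) 2^-1 half0.
- have [->|zw] := pselect (z = w).
    by rewrite subrr addr_ge0 // mulr_ge0 // hdist_ge0.
  have szw : s z <> s w by move/s_inj.
  have := hdist_intvec_ge1 (R := R) (s z) (s w) (h z) (h w) szw.
  have := normr_ge0 (h z - h w); have := h_bd2 z; have := h_bd2 w.
  by rewrite /=; lra.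
(* The bound 1/6 on the heights is sharp here: 1/6 = 1/2 (1/2 - 1/6). *)
- by rewrite /= normrN; have := h_bd z; lra.
set M := 6 * D%:R * n%:R.
have M1 : 1 <= M by rewrite /M; nra.
have s_bd z i : `|(s z i - z i)%:~R| <= D%:R :> R.
  by rewrite -intr_norm -[D%:R]/(D%:Z%:~R) ler_int.
have s_bd2 z i : - (D%:R : R) <= ((s z i - z i)%:~R : R) <= D%:R.
  by have := s_bd z i; rewrite ler_norml.
have exu i : exists u : P -> R, [/\ forall z, u (intvec R z, h z) = (s z i - z i)%:~R,
    forall p, 2^-1 <= `|p.2| -> u p = 0 &
    forall p q, `|u p - u q| <= 2^-1 * hdist p q + M * `|p.2 - q.2|].
  apply: (@strip_extension R k ('I_k -> int) (fun z => (intvec R z, h z))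
            (fun z => (s z i - z i)%:~R) M); first by lra.
  - move=> z w; have hd0 := hdist_ge0 (intvec R z, h z) (intvec R w, h w).
    have Mh0 : 0 <= M * `|h z - h w| by rewrite mulr_ge0 //; lra.
    have [->|/h_sep[hd|hh]] := pselect (z = w).
    + by rewrite subrr addr_ge0 ?mulr_ge0 ?hdist_ge0 //; lra.
    (* Same colour: two displacements differ by at most [2 D], which is half of the separation
       [4 D]. *)
    + have := s_bd2 z i; have := s_bd2 w i; move: hd; rewrite natrM /=; lra.
    (* Different colours: [M] is chosen so that the least height gap [1 / (3 n)] already pays for
       [2 D]. *)
    + have : M * (3 * n%:R)^-1 <= M * `|h z - h w| by rewrite ler_wpM2l //; lra.
      have -> : M * (3 * n%:R)^-1 = 2 * D%:R.
        by rewrite /M; field; rewrite gt_eqF //; lra.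
      by have := s_bd2 z i; have := s_bd2 w i; rewrite /=; lra.
  - move=> z; rewrite (le_trans (s_bd z i)) //=.
    apply: (@le_trans _ _ (M * 3^-1)); first by rewrite /M; nra.
    by rewrite ler_wpM2l //; [lra | have := h_bd z; lra].
have [u uP] := choice exu.
pose lift p : P := (p.1, p.2 + l p).
pose shift p : P := (fun i => p.1 i + u i p, p.2).
pose lower p : P := (p.1, p.2 + g p).
have bilip_lift : bilip 2 lift by exact: vertical_bilip.
have bilip_lower : bilip 2 lower by exact: vertical_bilip.
have bilip_shift : bilip (2 * M + 1) shift.
  by apply: horizontal_bilip => // i; case: (uP i).
(* On the vertical line through [p], [v] vanishes at heights 1/2 and -1/2 and has slope at most 1/2,
   so adding it cannot push [p] across the boundary. *)
have strip_stable (v : P -> R) : (forall p, 2^-1 <= `|p.2| -> v p = 0) ->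
    (forall p q, `|v p - v q| <= 2^-1 * hdist p q + 2^-1 * `|p.2 - q.2|) ->
    forall p, `|p.2| <= 2^-1 -> `|p.2 + v p| <= 2^-1.
  move=> v0 vL p p2.
  have hxx y : hdist p (p.1, y) = 0 by exact: (hdistxx p).
  have := p2; rewrite ler_norml => /andP[p2l p2u].
  have := vL p (p.1, 2^-1); have := vL p (p.1, - 2^-1).
  rewrite !hxx ![v (p.1, _)]v0 /= ?normrN ?[`|2^-1|]ger0_norm // !subr0 mulr0 !add0r opprK.
  rewrite [`|p.2 + 2^-1|]ger0_norm ?[`|p.2 - 2^-1|]ler0_norm; [|lra|lra].
  by rewrite !ler_norml; lra.
exists (lower \o (shift \o lift)); split.
- have -> : 4 * (2 * M + 1) = 2 * ((2 * M + 1) * 2) by ring.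
  by apply: bilip_comp => //; [lra | apply: bilip_comp => //; lra].
- move=> [x y] /= y2.
  rewrite /lift /shift /lower /= l0 // addr0.
  have -> : (fun i => x i + u i (x, y)) = x.
    by apply/funext => i; case: (uP i) => _ -> //; rewrite addr0.
  by rewrite g0 // addr0.
- move=> p /(strip_stable _ l0 lL) lp.
  exact: (strip_stable _ g0 gL (shift (lift p))).
- move=> z; rewrite /lift /shift /lower /= lE add0r.
  have -> : (fun i => intvec R z i + u i (intvec R z, h z)) = intvec R (s z).
    by apply/funext => i; case: (uP i) => -> _ _; rewrite /intvec -intrD subrKC.
  by rewrite gE subrr.
Qed.

End Realization.

(** * Return to the Euclidean metric *)

Section Euclidean.
Context {R : realType} {k : nat}.
Local Notation P := (('I_k -> R) * R)%type.
Implicit Types (p q : P) (f : P -> P).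

Lemma hdist_edist p q : hdist p q <= edist p q.
Proof.
apply: le_trans (supn_enorm _) _; rewrite ler_sqrt ?lerDl ?sqr_ge0 //.
by rewrite addr_ge0 ?sqr_ge0 // sumr_ge0 // => i _; rewrite sqr_ge0.
Qed.

Lemma edist_le_height p q : `|p.2 - q.2| <= edist p q.
Proof.
rewrite -sqrtr_sqr ler_sqrt; last first.
  by rewrite addr_ge0 ?sqr_ge0 // sumr_ge0 // => i _; rewrite sqr_ge0.
by rewrite lerDr sumr_ge0 // => i _; rewrite sqr_ge0.
Qed.

(** Each of the [k + 1] squared coordinate differences is at most the square of the sum distance;
    the resulting factor [sqrt (k + 1)] is rounded up to [k + 1]. *)
Lemma edist_le_hdist p q : edist p q <= k.+1%:R * (hdist p q + `|p.2 - q.2|).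
Proof.
have h0 := hdist_ge0 p q; have y0 := normr_ge0 (p.2 - q.2).
set e := hdist p q + _; have e0 : 0 <= e by rewrite addr_ge0.
have sum_le : \sum_(i < k) (p.1 i - q.1 i) ^+ 2 <= k%:R * e ^+ 2.
  rewrite mulr_natl -[k in _ *+ k]card_ord -sumr_const ler_sum // => i _.
  rewrite -[(_ - _) ^+ 2]real_normK ?num_real // lerXn2r ?nnegrE //.
  by apply: le_trans (le_supn (fun i => p.1 i - q.1 i) i) _; rewrite lerDl.
have y_le : (p.2 - q.2) ^+ 2 <= e ^+ 2.
  by rewrite -[(_ - _) ^+ 2]real_normK ?num_real // lerXn2r ?nnegrE // lerDr.
rewrite -[leRHS]ger0_norm; last by rewrite mulr_ge0.
rewrite -sqrtr_sqr ler_sqrt ?sqr_ge0 // exprMn.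
apply: (@le_trans _ _ (k.+1%:R * e ^+ 2)).
  by rewrite -natr1; lra.
by rewrite ler_wpM2r ?sqr_ge0 // expr2 ler_peMr // ler1n.
Qed.

Lemma edist_scale (c : R) p q p' q' : 0 <= c ->
  (forall i, p'.1 i - q'.1 i = c * (p.1 i - q.1 i)) ->
  p'.2 - q'.2 = c * (p.2 - q.2) -> edist p' q' = c * edist p q.
Proof.
move=> c0 e1 e2; rewrite /edist e2 (eq_bigr _ (fun i _ => congr1 (fun x => x ^+ 2) (e1 i))).
under eq_bigr do rewrite exprMn.
rewrite exprMn -mulr_sumr -mulrDr sqrtrM ?sqr_ge0 //.
by rewrite sqrtr_sqr ger0_norm.
Qed.

Lemma bilip_bilipschitz (K : R) f A : 0 <= K ->
  bilip K f -> bilipschitz_on (2 * k.+1%:R * K) A f.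
Proof.
move=> K0 fK.
have dist_le p q : hdist p q + `|p.2 - q.2| <= 2 * edist p q.
  by have := hdist_edist p q; have := edist_le_height p q; lra.
split=> [p q _ _ fpq|p q _ _|p q _ _].
- have [_] := fK p q; rewrite fpq hdistxx subrr normr0 addr0 mulr0 => pq0.
  have h0 := hdist_ge0 p q; have y0 := normr_ge0 (p.2 - q.2).
  have p2 : p.2 = q.2 by apply/eqP; rewrite -subr_eq0 -normr_le0; lra.
  have p1 : p.1 = q.1.
    apply/funext => i; apply/eqP; rewrite -subr_eq0 -normr_le0.
    by apply: le_trans (le_supn (fun i => p.1 i - q.1 i) i) _; rewrite -/(hdist p q); lra.
  by rewrite [p]surjective_pairing p1 p2 -surjective_pairing.
- apply: le_trans (edist_le_hdist _ _) _.
  have -> : 2 * k.+1%:R * K * edist p q = k.+1%:R * (K * (2 * edist p q)) by ring.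
  rewrite ler_wpM2l //; have [le1 _] := fK p q; apply: le_trans le1 _.
  by rewrite ler_wpM2l.
- apply: le_trans (edist_le_hdist _ _) _.
  have -> : 2 * k.+1%:R * K * edist (f p) (f q) =
     k.+1%:R * (K * (2 * edist (f p) (f q))) by ring.
  rewrite ler_wpM2l //; have [_ le1] := fK p q; apply: le_trans le1 _.
  by rewrite ler_wpM2l.
Qed.

Lemma edist_ge0 p q : 0 <= edist p q.
Proof. exact: sqrtr_ge0. Qed.

Lemma bilipschitz_on_le (L L' : R) A f :
  L <= L' -> bilipschitz_on L A f -> bilipschitz_on L' A f.
Proof.
move=> LL' [f_inj f1 f2]; split=> // p q Ap Aq.
  by apply: le_trans (f1 _ _ Ap Aq) _; rewrite ler_wpM2r ?edist_ge0.
by apply: le_trans (f2 _ _ Ap Aq) _; rewrite ler_wpM2r ?edist_ge0.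
Qed.

End Euclidean.

(** * Integer estimates of the bilipschitz constant *)

Definition realization_const (k D : nat) : nat :=
  (2 * k.+1 * (4 * (2 * (6 * D * (4 * D) ^ k) + 1)))%N.

Lemma realization (R : realType) (k D : nat) (s : ('I_k -> int) -> ('I_k -> int)) :
  (0 < D)%N -> injective s -> (forall z i, `|s z i - z i| <= D%:Z) ->
  exists f : ('I_k -> R) * R -> ('I_k -> R) * R,
    [/\ bilipschitz_on (realization_const k D)%:R setT f,
        forall p, 2^-1 <= `|p.2| -> f p = p,
        forall p, `|p.2| <= 2^-1 -> `|(f p).2| <= 2^-1 &
        forall z, f (intvec R z, 0) = (intvec R (s z), 0)].
Proof.
move=> D0 s_inj sD; have [f [fK f0 fS fE]] := displacement_realization (R := R) D s D0 s_inj sD.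
exists f; split=> //; rewrite /realization_const natrM natrM [(4 * _)%:R]natrM natrD.
rewrite [(2 * (_ * _))%:R]natrM [(_ * _ ^ _)%:R]natrM [(6 * _)%:R]natrM.
by apply: bilip_bilipschitz fK; rewrite mulr_ge0 // addr_ge0 // !mulr_ge0.
Qed.

(** With [n = (4 D)^k] the constant is [8 (k + 1) (12 D n + 1)], and [12 D n + 1 <= 13 D n]; hence
    104 = 8 * 13. *)
Lemma realization_const_le (k D : nat) : (0 < D)%N ->
  (realization_const k D <= 104 * (k.+1 * 4 ^ k * D ^ k.+1))%N.
Proof.
move=> D0; rewrite /realization_const expnMn expnS.
have : (0 < 4 ^ k)%N by rewrite expn_gt0.
have : (0 < D ^ k)%N by rewrite expn_gt0 D0.
by move: (4 ^ k)%N (D ^ k)%N => a b b0 a0; nia.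
Qed.

Lemma realization_const_exp (k D : nat) : (0 < D)%N ->
  (realization_const k D <= 2 ^ (8 * k.+1 * D))%N.
Proof.
move=> D0; apply: leq_trans (realization_const_le k D D0) _.
(* Uses [104 <= 2^7], [k + 1 <= 2^k] and [D <= 2^D]; the exponents add up to
   [7 + 3 k + D (k + 1)]. *)
apply: (@leq_trans (2 ^ 7 * (2 ^ k * (2 ^ 2) ^ k * (2 ^ D) ^ k.+1))%N).
  rewrite leq_mul // leq_mul ?leq_exp2r //; last exact/ltnW/ltn_expl.
  by rewrite leq_mul // ltn_expl.
by rewrite -!expnM -!expnD leq_exp2l //; nia.
Qed.

(** Since [12 D - 1 >= 11 D], it is enough to compare the powers of [D] and the numerical factors
    separately. The factor [104 (k + 1) 4^k] is below [11^(2 k + 1)] by induction from [k = 1],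
    where 832 <= 1331, and [2 k + 1 <= 3^k]. *)
Lemma realization_const_tower (k D : nat) : (0 < D)%N -> (0 < k)%N ->
  (realization_const k D <= (12 * D - 1) ^ (3 ^ k))%N.
Proof.
move=> D0; case: k => // k _; apply: leq_trans (realization_const_le k.+1 D D0) _.
apply: (@leq_trans ((11 * D) ^ (3 ^ k.+1))%N); last by rewrite leq_exp2r ?expn_gt0; lia.
have exp3 j : (2 * j + 1 <= 3 ^ j)%N by elim: j => // j IH; rewrite expnS; lia.
rewrite expnMn mulnA leq_mul //; last by rewrite leq_pexp2l //; have := exp3 k.+1; lia.
apply: (@leq_trans (11 ^ (2 * k.+1 + 1))%N); last by rewrite leq_pexp2l.
elim: k => // k IH.
have -> : (2 * k.+2 + 1 = 2 * k.+1 + 1 + 2)%N by lia.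
rewrite expnD [(4 ^ k.+2)%N]expnS.
have : (104 * (k.+3 * (4 * 4 ^ k.+1)) <= 104 * (k.+2 * 4 ^ k.+1) * 8)%N by nia.
by move/leq_trans; apply; rewrite leq_mul.
Qed.

(** * Block permutations and the exponential member of the family *)

Lemma half_le_intr (R : realType) (a b : int) :
  (- 2^-1 + a%:~R <= b%:~R :> R) = (a <= b).
Proof.
apply/idP/idP => [ab|]; last by rewrite -(ler_int R); lra.
rewrite leNgt; apply: contraT => /negPn; rewrite -lezD1 -(ler_int R) intrD; lra.
Qed.

Lemma le_half_intr (R : realType) (a b : int) :
  (b%:~R <= - 2^-1 + a%:~R :> R) = (b < a).
Proof.
apply/idP/idP => [ab|]; last by rewrite -lezD1 -(ler_int R) intrD; lra.
by rewrite ltNge; apply: contraT => /negPn; rewrite -(ler_int R); lra.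
Qed.

(** The offset 1/2 keeps lattice points off the faces of the closed cubes, so the cubes partition
    the lattice and integer division by [S] names the cube. *)
Lemma in_blockP (R : realType) (k S : nat) (w z : 'I_k -> int) : (0 < S)%N ->
  in_block R S w z <-> forall i, (z i %/ S)%Z = w i.
Proof.
move=> S0; have S0' : S%:Z != 0 by lia.
have boxE i : ((- 2^-1 + S%:R * (w i)%:~R <= (z i)%:~R :> R) =
      (S%:Z * w i <= z i)) *
   (((z i)%:~R <= - 2^-1 + S%:R + S%:R * (w i)%:~R :> R) = (z i < S%:Z + S%:Z * w i)).
  by split; rewrite -[S%:R]/(S%:Z%:~R) -?addrA -intrM -?intrD ?half_le_intr ?le_half_intr.
split=> [zw i|zw i].
  have [] := zw i; rewrite !boxE => le1 lt1.
  have -> : z i = w i * S + (z i - S%:Z * w i) by lia.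
  by rewrite divzMDl // divz_small ?addr0 //; lia.
rewrite !boxE -(zw i); have := divz_eq (z i) S; have := modz_ge0 (z i) S0'.
have := ltz_pmod (z i) (_ : 0 < S%:Z); lia.
Qed.

Lemma block_perm_dist (R : realType) (k S : nat) (s : ('I_k -> int) -> ('I_k -> int)) :
  (0 < S)%N -> block_perm R S s -> forall z i, `|s z i - z i| <= S%:Z.
Proof.
move=> S0 [_ s_block] z i; have S0' : S%:Z != 0 by lia.
have [+ _] := s_block (fun i => (z i %/ S)%Z).
move=> /(_ z); rewrite !in_blockP // => /(_ (fun=> erefl)) /(_ i) szE.
have := divz_eq (z i) S; have := divz_eq (s z i) S; rewrite szE.
have := modz_ge0 (z i) S0'; have := modz_ge0 (s z i) S0'.
have := ltz_pmod (z i) (_ : 0 < S%:Z); have := ltz_pmod (s z i) (_ : 0 < S%:Z); lia.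
Qed.

(** Besides giving the upper bound on [beta], this makes [F_fam] inhabited, so that [beta] is a
    genuine infimum and not the default value of [inf] on the empty set. *)
Lemma F_fam_pow2 (R : realType) (k : nat) :
  F_fam k.+1 (fun t : R => powR 2 (8 * k.+1%:R * t)).
Proof.
have ge0 t : 1 <= t -> 0 <= 8 * k.+1%:R * t :> R by move=> t1; rewrite !mulr_ge0 //; lra.
split; first split=> [t t1|s t s1 st].
- by rewrite -[leLHS](powRr0 2) ler_powR ?ler1n // ge0.
- by rewrite ler_powR ?ler1n // ler_wpM2l ?mulr_ge0.
move=> S s S0 s_perm; have [s_bij _] := s_perm.
have [f [fK f0 _ fE]] :=
  realization R k S s S0 (bij_inj s_bij) (block_perm_dist R k S s S0 s_perm).
exists f; split=> // [|p p2].
  apply: bilipschitz_on_le fK; rewrite -!natrM powR_mulrn // -natrX ler_nat.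
  exact: realization_const_exp.
apply: f0; rewrite leNgt; apply/negP => p2'; apply: p2.
by rewrite -ltr_norml.
Qed.

(** * Reflecting every block, and the lower bound for the family *)

Definition block_reflection (S : nat) (a : int) : int :=
  (a %/ S)%Z * S + (S%:Z - 1 - (a %% S)%Z).

Lemma block_reflection_div (S : nat) (a : int) : (0 < S)%N ->
  (block_reflection S a %/ S)%Z = (a %/ S)%Z.
Proof.
move=> S0; have S0' : S%:Z != 0 by lia.
have S1 : 0 < S%:Z by lia.
have := modz_ge0 a S0'; have := ltz_pmod a S1.
rewrite /block_reflection divzMDl //; move: (a %% S)%Z => r rS r0.
rewrite [X in _ + X]divz_small ?addr0 //. lia.
Qed.

Lemma block_reflectionK (S : nat) : (0 < S)%N -> involutive (block_reflection S).
Proof.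
move=> S0 a; rewrite {1}/block_reflection block_reflection_div //.
have := divz_eq (block_reflection S a) S; rewrite block_reflection_div //.
rewrite {1}/block_reflection; have := divz_eq a S.
by move: (block_reflection S a %% S)%Z (a %% S)%Z ((a %/ S)%Z * S) => r q b; lia.
Qed.

Lemma block_perm_reflection (R : realType) (k S : nat) : (0 < S)%N ->
  @block_perm R k S (fun z i => block_reflection S (z i)).
Proof.
move=> S0; have rK : involutive (fun (z : 'I_k -> int) i => block_reflection S (z i)).
  by move=> z; apply/funext => i; apply: block_reflectionK.
split=> [|w]; first exact: inv_bij.
have stable z : in_block R S w z -> in_block R S w (fun i => block_reflection S (z i)).
  by rewrite !in_blockP // => zw i; rewrite block_reflection_div.
split=> // z zw; exists (fun i => block_reflection S (z i)); first exact: stable.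
exact: rK.
Qed.

(* The neighbours [S - 1] and [S] lie in adjacent blocks; reflecting every
   block sends them to [0] and [2 S - 1]. *)
Lemma F_fam_ge (R : realType) (k : nat) (psi : R -> R) (S : nat) :
  (0 < S)%N -> F_fam k.+2 psi -> 2 * S%:R - 1 <= psi S%:R.
Proof.
move=> S0 [_ /(_ S _ S0 (block_perm_reflection R k.+1 S S0))[f [[_ fK _] _ fE]]].
pose pt (a : int) : 'I_k.+1 -> int := fun i => if i == ord0 then a else 0.
have := fK (intvec R (pt (S%:Z - 1)), 0) (intvec R (pt S), 0) I I.
rewrite !fE => le1.
have d1 : edist (intvec R (pt (S%:Z - 1)), 0) (intvec R (pt S), 0) = 1.
  rewrite /edist /= subrr expr0n addr0 big_ord_recl big1 => [|i _].
    by rewrite /intvec /pt eqxx -intrB addrAC subrr sub0r addr0 sqrrN expr1n sqrtr1.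
  by rewrite /intvec /pt /= subrr expr0n.
move: le1; rewrite d1 mulr1; apply: le_trans.
apply: le_trans (hdist_edist _ _); apply: le_trans (le_supn _ ord0).
rewrite /= /intvec /pt eqxx -intrB -intr_norm.
have -> : 2 * S%:R - 1 = (2 * S%:Z - 1)%:~R :> R by rewrite intrB intrM.
rewrite ler_int /block_reflection divzz modzz.
have -> : ((S%:Z - 1) %/ S)%Z = 0 by rewrite divz_small //; lia.
by rewrite modz_small; lia.
Qed.

(** * Bounds and monotonicity of [beta] *)

Lemma beta_ge (R : realType) (k : nat) (t : R) : 1 <= t ->
  2 * (Num.floor t)%:~R - 1 <= beta k.+2 t.
Proof.
move=> t1; have t_fl : 1 <= Num.floor t by rewrite floor_ge_int.
have flE : (Num.floor t)%:~R = `|Num.floor t|%N%:R :> R.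
  by rewrite -[RHS]/(_%:Z%:~R) gez0_abs //; lia.
have fl_le : `|Num.floor t|%N%:R <= t by rewrite -flE floor_le.
apply: lb_le_inf; first by eexists; eexists; [exact: F_fam_pow2|].
move=> _ [psi psiF <-]; have [[_ psi_mono] _] := psiF; rewrite flE.
apply: le_trans (F_fam_ge R k psi _ _ psiF) _; first by lia.
(* The reflection argument works only at integers, so its bound is taken at the floor of [t] and
   carried to [t] by monotonicity. *)
by apply: psi_mono => //; rewrite ler1n; lia.
Qed.

Lemma beta_le (R : realType) (k : nat) (psi : R -> R) (t : R) : 1 <= t ->
  F_fam k psi -> beta k t <= psi t.
Proof.
move=> t1 psiF; apply: ge_inf; last by exists psi.
by exists 1 => _ [phi [[phi1 _] _] <-]; apply: phi1.
Qed.

Lemma beta_monotone (R : realType) (k : nat) : monotone_ge1 (@beta R k.+1).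
Proof.
have img0 t : [set psi t | psi in @F_fam R k.+1] !=set0.
  by eexists; eexists; [exact: F_fam_pow2|].
split=> [t t1|s t s1 st].
  by apply: lb_le_inf => // _ [psi [[psi1 _] _] <-]; apply: psi1.
apply: lb_le_inf => // _ [psi psiF <-]; have [[_ psi_mono] _] := psiF.
apply: le_trans (beta_le R k.+1 psi s s1 psiF) _; exact: psi_mono.
Qed.

(** * Rescaling to the grid of mesh [1 / N], and conclusion *)

Lemma strip_realization (R : realType) (k T N : nat) (m : R)
    (sigma : ('I_k -> R) -> ('I_k -> R)) :
  (0 < T)%N -> (0 < N)%N ->
  (forall x, grid N x -> grid N (sigma x)) ->
  (forall x y, grid N x -> grid N y -> sigma x = sigma y -> x = y) ->
  (forall x, grid N x -> enorm (fun i => sigma x i - x i) <= T%:R) ->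
  exists Ups : ('I_k -> R) * R -> ('I_k -> R) * R,
    [/\ forall p, m - 2^-1 <= p.2 <= m + 2^-1 ->
          m - 2^-1 <= (Ups p).2 <= m + 2^-1,
        bilipschitz_on (realization_const k (N * T))%:R setT Ups,
        forall p, 2^-1 <= `|p.2 - m| -> Ups p = p &
        forall x, grid N x -> Ups (x, m) = (sigma x, m)].
Proof.
move=> T0 N0 sigma_grid sigma_inj sigma_bd.
have N1 : 1 <= N%:R :> R by rewrite ler1n.
have Nn0 : N%:R != 0 :> R by rewrite gt_eqF //; lra.
pose emb (z : 'I_k -> int) : 'I_k -> R := fun i => (z i)%:~R / N%:R.
have emb_grid z : grid N (emb z) by move=> i; exists (z i).
have emb_inj : injective emb.
  move=> z w zw; apply/funext => i; apply/eqP; rewrite -(eqr_int R); apply/eqP.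
  exact/(mulIf _ (congr1 (@^~ i) zw))/invr_neq0.
have gridP x : grid N x -> exists z, emb z = x.
  move=> /choice[z zE]; exists z; apply/funext => i; by rewrite zE.
have [s sE] := choice (fun z => gridP _ (sigma_grid _ (emb_grid z))).
have s_inj : injective s.
  move=> z w zw; apply: emb_inj; apply: sigma_inj => //; by rewrite -!sE zw.
have s_bd z i : `|s z i - z i| <= (N * T)%N%:Z.
  have := le_supn (fun i => sigma (emb z) i - emb z i) i.
  move=> /le_trans/(_ (supn_enorm _))/le_trans/(_ (sigma_bd _ (emb_grid z))).
  rewrite -sE /emb -mulrBl -intrB normrM [`|_^-1|]ger0_norm ?invr_ge0 //.
  rewrite ler_pdivrMr ?ltr0n // -intr_norm -natrM mulnC.
  by rewrite -[_%:R]/(_%:Z%:~R) ler_int.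
have NT0 : (0 < N * T)%N by rewrite muln_gt0 N0.
have [f [[f_inj f1 f2] f0 fS fE]] := realization R k (N * T) s NT0 s_inj s_bd.
(* Conjugating by a homothety of ratio [N] that takes height [m] to 0 turns the grid into the
   integer lattice and displacement [T] into [N T], and leaves the bilipschitz constant
   unchanged. *)
pose zoom (p : ('I_k -> R) * R) := ((fun i => N%:R * p.1 i), N%:R * (p.2 - m)).
pose unzoom (p : ('I_k -> R) * R) := ((fun i => N%:R^-1 * p.1 i), N%:R^-1 * p.2 + m).
have zoomK : cancel zoom unzoom.
  move=> [x y]; rewrite /zoom /unzoom /= mulKf // subrK.
  by congr (_, _); apply/funext => i; rewrite mulKf.
have unzoomK : cancel unzoom zoom.
  move=> [x y]; rewrite /zoom /unzoom /= addrK mulVKf //.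
  by congr (_, _); apply/funext => i; rewrite mulVKf.
have zoom_dist p q : edist (zoom p) (zoom q) = N%:R * edist p q.
  by apply: edist_scale => //= [i|]; ring.
have unzoom_dist p q : edist (unzoom p) (unzoom q) = N%:R^-1 * edist p q.
  by apply: edist_scale => //= [|i|]; [rewrite invr_ge0|ring|ring].
exists (unzoom \o (f \o zoom)); split.
- move=> p p_strip; suff : `|(f (zoom p)).2| <= N%:R * 2^-1.
    rewrite -ler_pdivrMl; last by lra.
    rewrite -[N%:R^-1]ger0_norm ?invr_ge0 // -normrM ler_norml /=; lra.
  have zp : `|(zoom p).2| <= N%:R * 2^-1.
    by rewrite /zoom /= normrM ger0_norm // ler_wpM2l // ler_norml; lra.
  (* The zoomed strip has half-width [N / 2 >= 1 / 2]: [f] preserves the inner strip of half-width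
     1/2 and is the identity beyond it. *)
  have [p2|p2] := leP `|(zoom p).2| 2^-1; first by apply: le_trans (fS _ p2) _; lra.
  by rewrite f0 // ltW.
- split=> [p q _ _|p q _ _|p q _ _].
  + by move=> /(can_inj unzoomK)/(f_inj _ _ I I)/(can_inj zoomK).
  + rewrite /= unzoom_dist mulrC ler_pdivrMr; last by lra.
    by rewrite -mulrA -[edist p q * _]mulrC -zoom_dist f1.
  + rewrite /= unzoom_dist mulrCA ler_pdivlMl; last by lra.
    by rewrite -zoom_dist f2.
- move=> p p2; rewrite /= f0 ?zoomK //= normrM ger0_norm //.
  by have := normr_ge0 (p.2 - m); nra.
- move=> _ /gridP[z <-]; rewrite -sE /=.
  have -> : zoom (emb z, m) = (intvec R z, 0).
    rewrite /zoom /= subrr mulr0; congr (_, _).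
    by apply/funext => i; rewrite /emb mulrC divfK.
  rewrite fE /unzoom /= mulr0 add0r; congr (_, _).
  by apply/funext => i; rewrite /emb mulrC.
Qed.

Theorem theorem5p1 (R : realType) (d : nat) (hd : (2 <= d)%N) :
  (* beta_d is a monotone increasing function [1,oo) -> [1,oo) *)
  monotone_ge1 (@beta R d) /\
  (* 2 floor(t) - 1 <= beta_d(t) <= 2^(8 d t) *)
  (forall t : R, 1 <= t ->
     2 * (Num.floor t)%:~R - 1 <= @beta R d t /\
     @beta R d t <= powR 2 (8 * d%:R * t)) /\
  (forall (T N : nat) (m : R) (sigma : ('I_d.-1 -> R) -> ('I_d.-1 -> R)),
     (0 < T)%N -> (0 < N)%N ->
     (* sigma is a permutation of (1/N) Z^(d-1) *)
     (forall x, grid N x -> grid N (sigma x)) ->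
     (forall x y, grid N x -> grid N y -> sigma x = sigma y -> x = y) ->
     (forall y, grid N y -> exists2 x, grid N x & sigma x = y) ->
     (forall x, grid N x -> enorm (fun i => sigma x i - x i) <= T%:R) ->
     exists Ups : ('I_d.-1 -> R) * R -> ('I_d.-1 -> R) * R,
       let strip := [set p : ('I_d.-1 -> R) * R | m - 2^-1 <= p.2 <= m + 2^-1] in
       [/\ (forall p, strip p -> strip (Ups p)),
           bilipschitz_on (N%:R * @beta R d (6 * N%:R * T%:R) ^+ (3 ^ d.-1)) strip Ups,
           (forall p, p.2 = m - 2^-1 \/ p.2 = m + 2^-1 -> Ups p = p) &
           (forall x, grid N x -> Ups (x, m) = (sigma x, m))]).
Proof.
case: d hd => [//|[//|k]] _; split; first exact: beta_monotone.
split=> [t t1|T N m sigma T0 N0 sigma_grid sigma_inj _ sigma_bd].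
  by split; [exact: beta_ge | exact: (beta_le _ _ _ _ t1 (F_fam_pow2 R k.+1))].
have [f [fS [f_inj f1 f2] f0 fE]] :=
  strip_realization R k.+1 T N m sigma T0 N0 sigma_grid sigma_inj sigma_bd.
have NT0 : (0 < N * T)%N by rewrite muln_gt0 N0.
exists f; split=> // [|p p2].
  apply: (@bilipschitz_on_le _ _ (realization_const k.+1 (N * T))%:R); last first.
    by split=> [p q _ _|p q _ _|p q _ _]; [exact: f_inj|exact: f1|exact: f2].
  have tE : 6 * N%:R * T%:R = (6 * (N * T))%N%:R :> R by rewrite !natrM mulrA.
  (* As [6 N T] is an integer, it is its own floor, and [beta_ge] gives [2 (6 N T) - 1], the base in
     [realization_const_tower] for [D = N T]. *)
  have b_ge : (12 * (N * T) - 1)%N%:R <= beta k.+2 (6 * N%:R * T%:R : R).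
    rewrite tE; have := @beta_ge R k (6 * (N * T))%N%:R; rewrite ler1n muln_gt0 NT0.
    rewrite -[X in Num.floor X]/((6 * (N * T))%N%:Z%:~R) intrKfloor => /(_ isT).
    apply: le_trans; rewrite -pmulrn natrB; last by rewrite muln_gt0.
    have -> : (12 * (N * T) = 2 * (6 * (N * T)))%N by lia.
    by rewrite natrM.
  apply: (@le_trans _ _ (beta k.+2 (6 * N%:R * T%:R) ^+ (3 ^ k.+1))).
    apply: le_trans (_ : (12 * (N * T) - 1)%N%:R ^+ (3 ^ k.+1) <= _).
      by rewrite -natrX ler_nat realization_const_tower.
    by rewrite lerXn2r ?nnegrE // (le_trans _ b_ge).
  by rewrite ler_peMl ?ler1n // exprn_ge0 //; apply: le_trans b_ge.
apply: f0; case: p2 => ->.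
  by rewrite addrAC subrr sub0r normrN ger0_norm ?invr_ge0.
by rewrite addrAC subrr add0r ger0_norm ?invr_ge0.
Qed.
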